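(* Let $X$ be a Hausdorff space and let $G$ be a countable group of homeomorphisms of $X$. Assume that for every non-empty open set $U\subset X$ the rigid stabilizer $G_U$ is non-amenable (respectively contains non-abelian free subgroups, is not elementary amenable, is not virtually solvable, is not locally finite). Then every non-trivial uniformly recurrent subgroup $\mathcal{H}$ of $G$ has the same property, i.e. every $H\in\mathcal{H}$ is non-amenable (respectively contains non-abelian free subgroups, is not elementary amenable, is not virtually solvable, is not locally finite).
   Context: A group of homeomorphisms of $X$ is a subgroup of $\mathrm{Homeo}(X)$. For $U\subset X$, the rigid stabilizer $G_U$ is the subgroup of $G$ consisting of elements that fix pointwise the complement $X\setminus U$. For a countable (discrete) group $G$, $\mathrm{Sub}(G)$ is the set of all subgroups of $G$ with the topology induced from the product topology on $\{0,1\}^G$ (Chabauty topology); it is compact and $G$ acts on it continuously by conjugation. A uniformly recurrent subgroup (URS) of $G$ is a (non-empty) closed, minimal, $G$-invariant subset $\mathcal{H}\subset\mathrm{Sub}(G)$. The trivial URS is $\{\{1\}\}$; a URS is non-trivial if it is different from it. A URS $\mathcal{H}$ is said to have a group property if every $H\in\mathcal{H}$ has it. *)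

(* Defs.v *)
From HB Require Import structures.
From mathcomp Require Import all_boot all_order ssralg ssrnum.
From mathcomp Require Import boolp classical_sets functions cardinality reals.
From mathcomp Require Import topology.

Set Implicit Arguments.
Unset Strict Implicit.
Unset Printing Implicit Defensive.

Local Open Scope classical_set_scope.
Local Open Scope group_scope.

#[local] Obligation Tactic := idtac.

Record subgroup (gT : groupType) := Subgroup {
  subgroup_set :> set gT;
  subgroup1 : subgroup_set 1;
  subgroupM : forall x y, subgroup_set x -> subgroup_set y -> subgroup_set (x * y);
  subgroupV : forall x, subgroup_set x -> subgroup_set x^-1 }.

Lemma subgroup_inj (gT : groupType) (H K : subgroup gT) :
  subgroup_set H = subgroup_set K -> H = K.
Proof.
case: H K => [A A1 AM AV] [B B1 BM BV] /= eqAB; subst B.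
by congr Subgroup; exact: Prop_irrelevance.
Qed.

Definition subgroup_type (gT : groupType) (H : subgroup gT) : Type :=
  set_type (subgroup_set H).

HB.instance Definition _ (gT : groupType) (H : subgroup gT) :=
  SubChoice.on (subgroup_type H).

Lemma subgroup_group_closed (gT : groupType) (H : subgroup gT) :
  group_closed (mem (subgroup_set H)).
Proof.
split; first exact/mem_set/subgroup1.
move=> x y /set_mem Hx /set_mem Hy; apply/mem_set.
by apply: subgroupM => //; exact: subgroupV.
Qed.

HB.instance Definition _ (gT : groupType) (H : subgroup gT) :=
  SubChoice_isSubGroup.Build gT (mem (subgroup_set H)) (subgroup_type H)
    (subgroup_group_closed H).

Program Definition full_subgroup (gT : groupType) : subgroup gT :=
  @Subgroup gT setT _ _ _.
Next Obligation. by []. Qed.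
Next Obligation. by []. Qed.
Next Obligation. by []. Qed.

Program Definition trivial_subgroup (gT : groupType) : subgroup gT :=
  @Subgroup gT [set 1] _ _ _.
Next Obligation. by []. Qed.
Next Obligation. by move=> gT x y /= -> ->; rewrite mulg1. Qed.
Next Obligation. by move=> gT x /= ->; rewrite invg1. Qed.

Program Definition generated (gT : groupType) (A : set gT) : subgroup gT :=
  @Subgroup gT [set x | forall H : subgroup gT, A `<=` H -> subgroup_set H x] _ _ _.
Next Obligation. by move=> gT A /= H _; exact: subgroup1. Qed.
Next Obligation.
by move=> gT A x y /= Ax Ay H AH; apply: subgroupM; [exact: Ax|exact: Ay].
Qed.
Next Obligation. by move=> gT A x /= Ax H AH; exact/subgroupV/Ax. Qed.

Program Definition kernel (gT hT : groupType) (f : {multiplicative gT -> hT}) :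
  subgroup gT := @Subgroup gT [set x | f x = 1] _ _ _.
Next Obligation.
by move=> gT hT f /=; apply: (mulgI (f 1)); rewrite -gmulfM !mulg1.
Qed.
Next Obligation. by move=> gT hT f x y /= fx fy; rewrite gmulfM fx fy mulg1. Qed.
Next Obligation.
move=> gT hT f x /= fx; apply: (mulgI (f x)); rewrite -gmulfM mulgV fx mulg1.
by apply: (mulgI (f 1)); rewrite -gmulfM !mulg1.
Qed.

(* h ^ g is g^-1 * h * g, so this is g H g^-1. *)
Program Definition conj_subgroup (gT : groupType) (g : gT) (H : subgroup gT) :
  subgroup gT := @Subgroup gT [set h ^ g^-1 | h in H] _ _ _.
Next Obligation.
by move=> gT g H /=; exists 1; rewrite ?conj1g//; exact: subgroup1.
Qed.
Next Obligation.
move=> gT g H _ _ /= [x Hx <-] [y Hy <-].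
by exists (x * y); rewrite ?conjMg//; exact: subgroupM.
Qed.
Next Obligation.
move=> gT g H _ /= [x Hx <-].
by exists x^-1; rewrite ?conjVg//; exact: subgroupV.
Qed.

Definition finite_index (gT : groupType) (H : subgroup gT) : Prop :=
  finite_set [set [set x * h | h in H] | x in [set: gT]].

HB.instance Definition _ (gT : groupType) := gen_eqMixin (subgroup gT).
HB.instance Definition _ (gT : groupType) := gen_choiceMixin (subgroup gT).

Definition subgroup_indicator (gT : groupType) (H : subgroup gT) :
  prod_topology (fun _ : gT => bool) := fun g => g \in subgroup_set H.

(* Chabauty topology: induced from {0,1}^gT, identifying subgroups with their
   indicator functions. *)
HB.instance Definition _ (gT : groupType) :=
  Topological.copy (subgroup gT) (initial_topology (@subgroup_indicator gT)).

Definition conj_invariant (gT : groupType) (Hs : set (subgroup gT)) : Prop :=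
  forall g H, Hs H -> Hs (conj_subgroup g H).

Definition urs (gT : groupType) (Hs : set (subgroup gT)) : Prop :=
  [/\ Hs !=set0, closed Hs, conj_invariant Hs &
      forall Ks : set (subgroup gT), Ks !=set0 -> closed Ks ->
        conj_invariant Ks -> Ks `<=` Hs -> Ks = Hs].

Definition abelian_group (gT : groupType) : Prop :=
  forall x y : gT, commute x y.

(* Existence of a left-invariant finitely additive probability measure on all
   subsets of the discrete group. *)
Definition amenable (R : realType) (gT : groupType) : Prop :=
  exists m : set gT -> R,
    [/\ forall A, (0 <= m A)%R,
        m setT = 1%R,
        forall A B, A `&` B = set0 -> m (A `|` B) = (m A + m B)%R &
        forall g A, m [set g * x | x in A] = m A].

(* The letter (x, true) stands for x, and (x, false) for x^-1. *)
Definition eval_word (gT : groupType) (w : seq (gT * bool)) : gT :=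
  \prod_(l <- w) (if l.2 then l.1 else l.1^-1).

Definition reduced_word (gT : groupType) (w : seq (gT * bool)) : bool :=
  sorted (fun l l' => ~~ ((l.1 == l'.1) && (l.2 != l'.2))) w.

Definition free_basis (gT : groupType) (B : set gT) : Prop :=
  forall g : gT, exists! w : seq (gT * bool),
    [/\ forall l, l \in w -> B l.1, reduced_word w & eval_word w = g].

Definition free_group (gT : groupType) : Prop :=
  exists B : set gT, free_basis B.

Definition has_nonabelian_free_subgroup (gT : groupType) : Prop :=
  exists F : subgroup gT,
    free_group (subgroup_type F) /\ ~ abelian_group (subgroup_type F).

(* The smallest class of groups containing finite and abelian groups and closed
   under subgroups, quotients, extensions and directed unions; quotients are
   given up to isomorphism, by surjective morphisms. *)
Inductive elementary_amenable : groupType -> Prop :=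
| EA_finite (gT : groupType) :
    finite_set [set: gT] -> elementary_amenable gT
| EA_abelian (gT : groupType) :
    abelian_group gT -> elementary_amenable gT
| EA_subgroup (gT : groupType) (H : subgroup gT) :
    elementary_amenable gT -> elementary_amenable (subgroup_type H)
| EA_quotient (gT hT : groupType) (f : {multiplicative gT -> hT}) :
    range f = setT -> elementary_amenable gT -> elementary_amenable hT
| EA_extension (gT hT : groupType) (f : {multiplicative gT -> hT}) :
    range f = setT -> elementary_amenable (subgroup_type (kernel f)) ->
    elementary_amenable hT -> elementary_amenable gT
| EA_directed_union (gT : groupType) (D : set (subgroup gT)) :
    (forall H K, D H -> D K -> exists L, [/\ D L, H `<=` L & K `<=` L]) ->
    (forall x : gT, exists2 H, D H & subgroup_set H x) ->
    (forall H, D H -> elementary_amenable (subgroup_type H)) ->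
    elementary_amenable gT.

Definition derived_subgroup (gT : groupType) (H : subgroup gT) : subgroup gT :=
  generated [set z : gT | exists x y, [/\ subgroup_set H x, subgroup_set H y & z = [~ x, y]]].

Definition solvable_group (gT : groupType) : Prop :=
  exists n, iter n (@derived_subgroup gT) (full_subgroup gT) = trivial_subgroup gT.

Definition virtually_solvable (gT : groupType) : Prop :=
  exists H : subgroup gT, finite_index H /\ solvable_group (subgroup_type H).

Definition locally_finite_group (gT : groupType) : Prop :=
  forall A : set gT, finite_set A -> finite_set (generated A).

Record homeo (X : topologicalType) := Homeo {
  homeo_fun :> X -> X;
  homeo_inv : X -> X;
  homeoK : cancel homeo_fun homeo_inv;
  homeoVK : cancel homeo_inv homeo_fun;
  homeo_continuous : continuous homeo_fun;
  homeo_inv_continuous : continuous homeo_inv }.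

Lemma homeo_eq (X : topologicalType) (f g : homeo X) : f =1 g -> f = g.
Proof.
case: f g => [f f' fK f'K cf cf'] [g g' gK g'K cg cg'] /= /funext eqfg; subst g.
have eqf'g' : f' = g' by apply/funext => x; rewrite -{1}(g'K x) fK.
by subst g'; congr Homeo; exact: Prop_irrelevance.
Qed.

HB.instance Definition _ (X : topologicalType) := gen_eqMixin (homeo X).
HB.instance Definition _ (X : topologicalType) := gen_choiceMixin (homeo X).

Section HomeoGroup.
Variable X : topologicalType.
Implicit Types f g : homeo X.

Definition homeo_one : homeo X :=
  @Homeo X id id (fun=> erefl) (fun=> erefl) (fun=> cvg_id) (fun=> cvg_id).

Definition homeo_sym f : homeo X :=
  Homeo (@homeoVK _ f) (@homeoK _ f)
    (@homeo_inv_continuous _ f) (@homeo_continuous _ f).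

Lemma homeo_comp_continuous f g : continuous (f \o g).
Proof.
by move=> x; apply: continuous_comp; exact: homeo_continuous.
Qed.

Lemma homeo_comp_inv_continuous f g : continuous (homeo_inv g \o homeo_inv f).
Proof.
by move=> x; apply: continuous_comp; exact: homeo_inv_continuous.
Qed.

Definition homeo_comp f g : homeo X :=
  Homeo (can_comp (@homeoK _ f) (@homeoK _ g))
    (can_comp (@homeoVK _ g) (@homeoVK _ f))
    (@homeo_comp_continuous f g) (@homeo_comp_inv_continuous f g).

Lemma homeo_compA : associative homeo_comp.
Proof. by move=> f g h; exact: homeo_eq. Qed.

Lemma homeo_comp1l : left_id homeo_one homeo_comp.
Proof. by move=> f; exact: homeo_eq. Qed.

Lemma homeo_comp1r : right_id homeo_one homeo_comp.
Proof. by move=> f; exact: homeo_eq. Qed.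

Lemma homeo_compVl : left_inverse homeo_one homeo_sym homeo_comp.
Proof. by move=> f; apply: homeo_eq => x /=; rewrite homeoK. Qed.

Lemma homeo_compVr : right_inverse homeo_one homeo_sym homeo_comp.
Proof. by move=> f; apply: homeo_eq => x /=; rewrite homeoVK. Qed.

HB.instance Definition _ := isGroup.Build (homeo X)
  homeo_compA homeo_comp1l homeo_comp1r homeo_compVl homeo_compVr.

End HomeoGroup.

Program Definition rigid_stabilizer (X : topologicalType)
    (G : subgroup (homeo X)) (U : set X) : subgroup (subgroup_type G) :=
  @Subgroup (subgroup_type G)
    [set g | forall x, (~` U) x -> (val g : homeo X) x = x] _ _ _.
Next Obligation. by []. Qed.
Next Obligation. by move=> X G U f g /= fU gU x Ux; rewrite gU// fU. Qed.
Next Obligation.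
by move=> X G U g /= gU x Ux; rewrite -[in LHS](gU x Ux) homeoK.
Qed.

(* Main.v *)
Require Import Defs.
From HB Require Import structures.
From mathcomp Require Import all_boot all_order ssralg ssrnum.
From mathcomp Require Import boolp classical_sets functions cardinality reals.
From mathcomp Require Import topology.

Set Implicit Arguments.
Unset Strict Implicit.
Unset Printing Implicit Defensive.

Local Open Scope classical_set_scope.

(** The heart of the matter is that any member H of a non-trivial uniformly
    recurrent subgroup has some rigid stabilizer G_V, with V open and
    non-empty, among its subquotients: a subgroup of H maps onto G_V
    ([urs_subquotient]).  The theorem follows because amenability, elementary
    amenability, virtual solvability and local finiteness are inherited by
    subquotients, while a non-abelian free subgroup of a subquotient lifts to
    the ambient group.

    A non-trivial URS does not contain the trivial subgroup, because the
    singleton of the trivial subgroup is closed and invariant.  It is closed, so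
    it also avoids a whole neighbourhood of the trivial subgroup; unfolding the
    topology, there is a finite set P of non-trivial elements meeting every
    member of the URS ([urs_hitting_set]).  In particular P meets every
    conjugate of H.

    If X has an isolated point x, take V = {x}: its rigid stabilizer is trivial.
    Otherwise the Hausdorff property gives non-empty open sets U_p, for p in P,
    which are pairwise disjoint and such that p U_p is disjoint from every U_q
    ([disjoint_displaced_open_sets]).  Choose c_p in the rigid stabilizer of
    U_p for each p and glue these elements into one d in G that acts as c_p on
    U_p and trivially elsewhere.  Some p in P lies in d H d^-1, so that
    h = d^-1 p d belongs to H, and h = p c_p on U_p because d fixes p U_p
    pointwise.  As the c_p are independent of each other, one p must work for
    all elements c of the rigid stabilizer of U_p: if every p had a bad c_p,
    gluing the bad choices would be contradictory.  For this p, writing h_c for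
    the element of H that agrees with p c on U_p, the element h_1^-1 h_c of H
    preserves U_p and acts on it as c.  Hence restriction to U_p maps the
    subgroup of the elements of H that act on U_p as rigid elements onto the
    rigid stabilizer of U_p ([rigid_stabilizer_subquotient]). *)

(** * Partially defined homomorphisms and subquotients *)

Local Open Scope group_scope.

Local Notation "x \inG H" := (subgroup_set H x) (at level 70, no associativity).

(** A homomorphism defined on a subgroup is encoded as a total function with
    irrelevant values off its domain, so that composing and restricting do not
    change carrier types. *)
Record partial_hom (gT hT : groupType) := PartialHom {
  phom_dom : subgroup gT;
  phom_fun :> gT -> hT;
  phomM : forall x y, x \inG phom_dom -> y \inG phom_dom ->
    phom_fun (x * y) = phom_fun x * phom_fun y }.

Definition subquotient (gT hT : groupType) : Prop :=
  exists f : partial_hom gT hT,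
    forall y, exists2 x, x \inG phom_dom f & f x = y.

Section PartialHomTheory.
Variables (gT hT : groupType) (f : partial_hom gT hT).
Notation K := (phom_dom f).

Lemma phom1 : f 1 = 1.
Proof. by apply: (mulgI (f 1)); rewrite -phomM ?mulg1//; exact: subgroup1. Qed.

Lemma phomV x : x \inG K -> f x^-1 = (f x)^-1.
Proof.
move=> Kx; apply: (mulgI (f x)).
by rewrite -phomM ?mulgV ?phom1//; exact: subgroupV.
Qed.

Lemma phomR x y : x \inG K -> y \inG K -> f [~ x, y] = [~ f x, f y].
Proof.
have KM := @subgroupM _ K; have KV := @subgroupV _ K.
by move=> Kx Ky; rewrite /commg /conjg !phomM ?phomV//; auto 6.
Qed.

Program Definition phom_image (S : subgroup gT) : subgroup hT :=
  @Subgroup hT (f @` (subgroup_set K `&` S)) _ _ _.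
Next Obligation.
by move=> S; exists 1; rewrite ?phom1//; split; exact: subgroup1.
Qed.
Next Obligation.
move=> S _ _ [x [Kx Sx] <-] [y [Ky Sy] <-]; exists (x * y); last exact: phomM.
by split; exact: subgroupM.
Qed.
Next Obligation.
move=> S _ [x [Kx Sx] <-]; exists x^-1; last exact: phomV.
by split; exact: subgroupV.
Qed.

End PartialHomTheory.

Lemma subgroup_typeP (gT : groupType) (H : subgroup gT) (x : subgroup_type H) :
  val x \inG H.
Proof. exact/set_mem/(valP x). Qed.

Lemma val_insubd_subgroup (gT : groupType) (H : subgroup gT) (x : gT) :
  x \inG H -> val (insubd (1 : subgroup_type H) x) = x.
Proof. by move=> Hx; rewrite insubdK//; apply/mem_set. Qed.

Lemma subvalM (gT : groupType) (H : subgroup gT) (x y : subgroup_type H) :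
  val (x * y) = val x * val y.
Proof. by []. Qed.

Section Composition.
Variables (gT hT kT : groupType).
Variables (f : partial_hom hT kT) (g : partial_hom gT hT).

Program Definition phom_comp_dom : subgroup gT :=
  @Subgroup gT [set x | x \inG phom_dom g /\ g x \inG phom_dom f] _ _ _.
Next Obligation. by split; rewrite ?phom1; exact: subgroup1. Qed.
Next Obligation.
by move=> x y [? ?] [? ?]; split; rewrite ?phomM//; exact: subgroupM.
Qed.
Next Obligation.
by move=> x [? ?]; split; rewrite ?phomV//; exact: subgroupV.
Qed.

Program Definition phom_comp : partial_hom gT kT :=
  @PartialHom gT kT phom_comp_dom (f \o g) _.
Next Obligation. by move=> x y [? ?] [? ?] /=; rewrite !phomM. Qed.

End Composition.

Program Definition phom_val (gT : groupType) (S : subgroup gT) :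
  partial_hom (subgroup_type S) gT :=
  @PartialHom _ _ (full_subgroup (subgroup_type S)) val _.
Next Obligation. by []. Qed.

Program Definition phom_insub (gT : groupType) (S : subgroup gT) :
  partial_hom gT (subgroup_type S) :=
  @PartialHom _ _ S (insubd (1 : subgroup_type S)) _.
Next Obligation.
move=> gT S x y Sx Sy; apply: val_inj; rewrite subvalM !val_insubd_subgroup//.
exact: subgroupM.
Qed.

Lemma subquotient_sub (gT hT : groupType) (T : subgroup hT) :
  subquotient gT hT -> subquotient gT (subgroup_type T).
Proof.
move=> [f f_onto]; exists (phom_comp (phom_insub T) f) => y.
have Ty := subgroup_typeP y; have [x Kx fx] := f_onto (val y).
exists x; first by split; rewrite // fx.
by apply: val_inj; rewrite /= fx val_insubd_subgroup.
Qed.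

Lemma subquotient_restr (gT hT : groupType) (f : partial_hom gT hT)
    (S : subgroup gT) (T : subgroup hT) :
  T `<=` phom_image f S -> subquotient (subgroup_type S) (subgroup_type T).
Proof.
move=> TS; exists (phom_comp (phom_insub T) (phom_comp f (phom_val S))) => y.
have [x [Kx Sx] fx] := TS _ (subgroup_typeP y).
have Ty := subgroup_typeP y.
exists (insubd (1 : subgroup_type S) x).
  by rewrite /= val_insubd_subgroup// fx.
by apply: val_inj; rewrite /= val_insubd_subgroup val_insubd_subgroup// fx.
Qed.

(** * Smallness properties inherited by subquotients *)

(** Choosing representatives of the right cosets of the domain K of f gives a
    map phi from gT to hT with phi (k g) = f k * phi g for k in K; the image of
    an invariant mean under such a map is an invariant mean. *)
Lemma subquotient_amenable (R : realType) (gT hT : groupType) :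
  subquotient gT hT -> amenable R gT -> amenable R hT.
Proof.
move=> [f f_onto] [m [m_ge0 mT mU mM]].
pose Kcoset g := [set x | g * x^-1 \inG phom_dom f].
pose rep g := xget 1 (Kcoset g).
have repP g : g * (rep g)^-1 \inG phom_dom f.
  have Kgg : Kcoset g g by rewrite /Kcoset /= mulgV; exact: subgroup1.
  exact: (xgetPex 1 (ex_intro _ g Kgg)).
have repM k g : k \inG phom_dom f -> rep (k * g) = rep g.
  move=> Kk; congr xget; apply/seteqP.
  split=> x; rewrite /Kcoset /= => Kx; last first.
    by rewrite -mulgA; exact: subgroupM.
  rewrite -[g](mulKg k) -mulgA; apply: subgroupM => //; exact: subgroupV.
pose phi g := f (g * (rep g)^-1).
have phiM k g : k \inG phom_dom f -> phi (k * g) = f k * phi g.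
  by move=> Kk; rewrite /phi repM// -mulgA phomM.
exists (fun A => m (phi @^-1` A)); split => //.
- move=> A B AB0.
  by rewrite preimage_setU mU// -preimage_setI AB0 preimage_set0.
- move=> h A; have [k Kk <-] := f_onto h; rewrite -[RHS](mM k); congr m.
  apply/seteqP; split=> [g [a Aa /= ag]|_ [g Ag <-]] /=; last first.
    by exists (phi g); rewrite ?phiM.
  exists (k^-1 * g); last by rewrite mulVKg.
  rewrite /= phiM; last exact: subgroupV.
  by rewrite phomV// -ag mulKg.
Qed.

Lemma subquotient_elementary_amenable (gT hT : groupType) :
  subquotient gT hT -> elementary_amenable gT -> elementary_amenable hT.
Proof.
move=> [f f_onto] EAgT.
pose g (x : subgroup_type (phom_dom f)) := f (val x).
have gM : {morph g : x y / x * y}.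
  by move=> x y; rewrite /g subvalM phomM//; exact: subgroup_typeP.
(* A partial homomorphism is a genuine morphism on the group of its domain,
   to which the closure of the class under quotients applies. *)
pose gmix := isMultiplicative.Build _ _ g gM.
pose gmor : {multiplicative subgroup_type (phom_dom f) -> hT} :=
  HB.pack g gmix.
apply: (@EA_quotient _ _ gmor); last exact: EA_subgroup.
apply/seteqP; split=> // y _; have [x Kx <-] := f_onto y.
exists (insubd (1 : subgroup_type (phom_dom f)) x) => //=.
by rewrite /g val_insubd_subgroup.
Qed.

Lemma generated_sub (gT : groupType) (A : set gT) (H : subgroup gT) :
  A `<=` H -> generated A `<=` H.
Proof. by move=> AH x; apply. Qed.

Lemma sub_generated (gT : groupType) (A : set gT) : A `<=` generated A.
Proof. by move=> x Ax H; apply. Qed.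

(** A finite set A lifts to a finite set, and the image of the subgroup which
    the lift generates is a subgroup containing A. *)
Lemma subquotient_locally_finite (gT hT : groupType) :
  subquotient gT hT -> locally_finite_group gT -> locally_finite_group hT.
Proof.
move=> [f f_onto] LFgT A finA.
have /choice[s sP] : forall y, exists x, x \inG phom_dom f /\ f x = y.
  by move=> y; have [x Kx fx] := f_onto y; exists x.
pose S := generated (s @` A).
have finS : finite_set S by apply: LFgT; exact: finite_image.
apply: (@sub_finite_set _ _ (f @` S)); last exact: finite_image.
apply: (@subset_trans _ (phom_image f S)); last first.
  by move=> _ [x [_ Sx] <-]; exists x.
apply: generated_sub => y Ay; have [Ksy fsy] := sP y.
by exists (s y) => //; split=> //; apply: sub_generated; exists y.
Qed.

Lemma derived_series_image (gT hT : groupType) (f : partial_hom gT hT) n :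
  (forall y, exists2 x, x \inG phom_dom f & f x = y) ->
  iter n (@derived_subgroup hT) (full_subgroup hT) `<=`
    phom_image f (iter n (@derived_subgroup gT) (full_subgroup gT)).
Proof.
move=> f_onto; elim: n => [y _|n IHn].
  by have [x Kx <-] := f_onto y; exists x.
apply: generated_sub => _ [_ [_ [/IHn[x [Kx Dx] <-] /IHn[y [Ky Dy] <-] ->]]].
exists [~ x, y]; last exact: phomR.
split; last by apply: sub_generated; exists x, y.
have KM := @subgroupM _ (phom_dom f); have KV := @subgroupV _ (phom_dom f).
by rewrite /commg /conjg; auto 6.
Qed.

Lemma subquotient_solvable (gT hT : groupType) :
  subquotient gT hT -> solvable_group gT -> solvable_group hT.
Proof.
move=> [f f_onto] [n Dn1]; exists n; apply/subgroup_inj/seteqP.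
split=> [y /(derived_series_image f_onto)|_ ->]; last exact: subgroup1.
by rewrite Dn1 => -[_ [_ ->] <-]; exact: phom1.
Qed.

(** Sending a coset C of S to f (C meet the domain) reaches every coset of the
    image of S. *)
Lemma subquotient_finite_index (gT hT : groupType) (f : partial_hom gT hT)
    (S : subgroup gT) :
  (forall y, exists2 x, x \inG phom_dom f & f x = y) ->
  finite_index S -> finite_index (phom_image f S).
Proof.
move=> f_onto finS.
apply: (@sub_finite_set _ _
  ((fun C => f @` (subgroup_set (phom_dom f) `&` C)) @`
     [set [set x * h | h in S] | x in [set: gT]])); last exact: finite_image.
move=> _ [y _ <-]; have [x Kx <-] := f_onto y.
exists [set x * h | h in S]; first by exists x.
apply/seteqP.
split=> [_ [_ [/[swap] -[s Ss <-] Kxs] <-]|_ [_ [s [Ks Ss] <-] <-]].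
  have Ks : s \inG phom_dom f.
    by rewrite -[s](mulKg x); apply: subgroupM => //; exact: subgroupV.
  by exists (f s); rewrite ?phomM//; exists s.
exists (x * s); last by rewrite phomM.
by split; [exact: subgroupM|exists s].
Qed.

(** The image of a solvable subgroup of finite index is such a subgroup. *)
Lemma subquotient_virtually_solvable (gT hT : groupType) :
  subquotient gT hT -> virtually_solvable gT -> virtually_solvable hT.
Proof.
move=> [f f_onto] [S [finS solS]]; exists (phom_image f S); split.
  exact: subquotient_finite_index.
by apply: subquotient_solvable solS; exact: (@subquotient_restr _ _ f).
Qed.

(** * Lifting free subgroups along subquotients *)

Lemma subquotient_abelian (gT hT : groupType) :
  subquotient gT hT -> abelian_group gT -> abelian_group hT.
Proof.
move=> [f f_onto] abelG y y'.
have [[x Kx <-] [x' Kx' <-]] := (f_onto y, f_onto y').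
by rewrite /commute -!phomM// abelG.
Qed.

Section Words.
Variable gT : groupType.
Implicit Types (A : set gT) (w : seq (gT * bool)).

Definition word_over A w : Prop := forall l, l \in w -> A l.1.

Lemma word_over_cons A l w : A l.1 -> word_over A w -> word_over A (l :: w).
Proof. by move=> Al Aw l'; rewrite inE => /predU1P[->|/Aw]. Qed.

Lemma word_over_behead A l w : word_over A (l :: w) -> word_over A w.
Proof. by move=> Aw l' wl'; apply: Aw; rewrite inE wl' orbT. Qed.

Lemma eval_word_nil : eval_word [::] = 1 :> gT.
Proof. by rewrite /eval_word big_nil. Qed.

Lemma eval_word_cons (l : gT * bool) w :
  eval_word (l :: w) = (if l.2 then l.1 else l.1^-1) * eval_word w.
Proof. by rewrite /eval_word big_cons. Qed.

Lemma eval_word_cat w1 w2 : eval_word (w1 ++ w2) = eval_word w1 * eval_word w2.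
Proof. by rewrite /eval_word big_cat. Qed.

Lemma eval_wordV A w : word_over A w ->
  exists2 w', word_over A w' & eval_word w' = (eval_word w)^-1.
Proof.
elim: w => [|[x b] w IHw] Aw.
  by exists [::]; rewrite // eval_word_nil invg1.
have [w' Aw' ew'] := IHw (word_over_behead Aw).
exists (w' ++ [:: (x, ~~ b)]) => [l|].
  rewrite mem_cat => /orP[/Aw'//|]; rewrite inE => /eqP-> /=.
  by apply: (Aw (x, b)); rewrite mem_head.
rewrite eval_word_cat !eval_word_cons eval_word_nil ew' invgM mulg1.
by case: b {Aw} => //=; rewrite invgK.
Qed.

(** The values of words over A form a subgroup. *)
Lemma generated_word A (x : gT) : x \inG generated A ->
  exists2 w, word_over A w & eval_word w = x.
Proof.
have @W : subgroup gT.
  exists [set x | exists2 w, word_over A w & eval_word w = x].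
  - by exists [::]; rewrite ?eval_word_nil.
  - move=> _ _ [w1 Aw1 <-] [w2 Aw2 <-]; exists (w1 ++ w2) => [l|].
      by rewrite mem_cat => /orP[/Aw1|/Aw2].
    exact: eval_word_cat.
  - by move=> _ [w Aw <-]; exact: eval_wordV.
move=> /(_ W); apply=> a Aa; exists [:: (a, true)].
  by move=> l; rewrite inE => /eqP->.
by rewrite eval_word_cons eval_word_nil mulg1.
Qed.

(** Letters are added on the left one at a time, cancelling the new letter
    against the head of an already reduced word when they are inverse. *)
Lemma reduced_word_exists A w : word_over A w ->
  exists w', [/\ word_over A w', reduced_word w' & eval_word w' = eval_word w].
Proof.
elim: w => [|l w IHw] Aw; first by exists [::].
have [w' [Aw' rw' ew']] := IHw (word_over_behead Aw).
have Al : A l.1 by apply: Aw; rewrite mem_head.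
case: w' => [|l' w'] in Aw' rw' ew' *.
  exists [:: l]; split=> //; first exact: word_over_cons.
  by rewrite !eval_word_cons ew'.
case: (boolP ((l.1 == l'.1) && (l.2 != l'.2))) => [/andP[/eqP l1 l2]|ll'].
  exists w'; split; first exact: (word_over_behead Aw').
    by move: rw'; exact: path_sorted.
  rewrite eval_word_cons -ew' eval_word_cons l1.
  by case: l.2 l'.2 l2 => -[]// _; rewrite ?mulKg ?mulVKg.
exists (l :: l' :: w'); split; first exact: word_over_cons.
  by rewrite /reduced_word /= ll'.
by rewrite eval_word_cons ew' -eval_word_cons.
Qed.

End Words.

Definition map_word (gT hT : groupType) (s : gT -> hT) (w : seq (gT * bool)) :=
  [seq (s l.1, l.2) | l <- w].

Lemma eval_map_word (gT hT : groupType) (f : partial_hom gT hT) w :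
  word_over (phom_dom f) w ->
  eval_word w \inG phom_dom f /\ f (eval_word w) = eval_word (map_word f w).
Proof.
elim: w => [_|[x b] w IHw Kw].
  by rewrite !eval_word_nil phom1; split=> //; exact: subgroup1.
have [Kew fw] := IHw (word_over_behead Kw).
have Kx : x \inG phom_dom f by apply: (Kw (x, b)); rewrite mem_head.
have Kb : (if b then x else x^-1) \inG phom_dom f.
  by case: b {Kw} => //; exact: subgroupV.
rewrite !eval_word_cons /= phomM// fw; split; first exact: subgroupM.
by case: b {Kw Kb} => //; rewrite phomV.
Qed.

Lemma reduced_map_word (gT hT : groupType) (A : set gT) (s : gT -> hT) w :
  {in A &, injective s} -> word_over A w ->
  reduced_word w -> reduced_word (map_word s w).
Proof.
move=> s_inj Aw; rewrite /reduced_word sorted_map.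
have Amem : {in w &, forall l l', s l.1 = s l'.1 -> l.1 = l'.1}.
  by move=> l l' /Aw Al /Aw Al'; apply: s_inj; exact/mem_set.
apply: (@sub_in_sorted _ (mem w)); last exact/allP.
move=> l l' wl wl'; apply: contra => /andP[/= /eqP sll' ->].
by rewrite (Amem l l')// eqxx.
Qed.

(** Free groups are projective: the subgroup F generated by arbitrary lifts of
    a basis B is free on them.  A relation between reduced words in the lifts is
    mapped by f to a relation between reduced words in B, which is trivial. *)
Lemma free_basis_lift (gT hT : groupType) (f : partial_hom gT hT) (B : set hT) :
  (forall y, exists2 x, x \inG phom_dom f & f x = y) -> free_basis B ->
  exists F : subgroup gT,
    free_group (subgroup_type F) /\ subquotient (subgroup_type F) hT.
Proof.
move=> f_onto freeB.
have /choice[s sP] : forall y, exists x, x \inG phom_dom f /\ f x = y.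
  by move=> y; have [x Kx fx] := f_onto y; exists x.
pose F := generated (s @` B).
have FK : F `<=` phom_dom f.
  by apply: generated_sub => _ [y _ <-]; exact: (sP y).1.
pose p := phom_comp f (phom_val F).
have Kp (x : subgroup_type F) : x \inG phom_dom p.
  by split=> //; exact/FK/subgroup_typeP.
pose t y := insubd (1 : subgroup_type F) (s y).
pose B' := t @` B.
have val_t y : B y -> val (t y) = s y.
  by move=> By; rewrite val_insubd_subgroup//; apply: sub_generated; exists y.
have tK y : B y -> p (t y) = y by move=> By /=; rewrite val_t// (sP y).2.
have pB' x : B' x -> B (p x) by move=> [y By <-]; rewrite tK.
have pK x : B' x -> t (p x) = x by move=> [y By <-]; rewrite tK.
exists F; split; last first.
  exists p => y; have [w [[Bw _ <-] _]] := freeB y.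
  exists (eval_word (map_word t w)); first exact: Kp.
  rewrite (@eval_map_word _ _ p _ _).2 => [|l _]; last exact: Kp.
  rewrite /map_word -map_comp; congr eval_word; rewrite -[RHS]map_id.
  by apply/eq_in_map => -[y' b] /Bw/tK/= ->.
exists B' => g.
have B'_word : exists2 w, word_over B' w & eval_word w = g.
  have [w sBw ew] := generated_word (subgroup_typeP g).
  have Fw : word_over (phom_dom (phom_insub F)) w.
    by move=> l /sBw; exact: sub_generated.
  exists (map_word (phom_insub F) w).
    by move=> _ /mapP[l /sBw[y By sy] ->]; exists y => //=; rewrite /t sy.
  by rewrite -(eval_map_word Fw).2 ew; exact: valKd.
have [w B'w ew] := B'_word; have [w' [B'w' rw' ew']] := reduced_word_exists B'w.
exists w'; split=> [|w2 [B'w2 rw2 ew2]]; first by split; rewrite // ew'.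
have [u [_ u_uniq]] := freeB (p g).
have p_inj : {in B' &, injective p}.
  by move=> x y /set_mem/pK {2}<- /set_mem/pK {2}<- ->.
have uE v : word_over B' v -> reduced_word v -> eval_word v = g ->
    v = map_word t u.
  move=> B'v rv ev; rewrite (u_uniq (map_word p v)); last first.
    split; last by rewrite -ev (@eval_map_word _ _ p _ _).2// => l _; exact: Kp.
      by move=> _ /mapP[l /B'v/pB' Bl ->].
    exact: (reduced_map_word p_inj).
  rewrite /map_word -map_comp -[LHS]map_id.
  by apply/eq_in_map => -[y b] /B'v/pK/= ->.
by rewrite (uE w')// ?ew'// -(uE w2).
Qed.

Lemma subquotient_nonabelian_free (gT hT : groupType) :
  subquotient gT hT -> has_nonabelian_free_subgroup hT ->
  has_nonabelian_free_subgroup gT.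
Proof.
move=> sq [T [[B freeB] nabT]].
have [f f_onto] := subquotient_sub T sq.
have [F [freeF sqF]] := free_basis_lift f_onto freeB.
by exists F; split=> // /(subquotient_abelian sqF).
Qed.

(** * The trivial subgroup in the Chabauty topology *)

Lemma eval_indicator_continuous (gT : groupType) (g : gT) :
  continuous (fun H : subgroup gT => (g \in subgroup_set H) : bool).
Proof.
move=> H; apply: (@continuous_comp _ (prod_topology (fun=> bool)) _
  (@subgroup_indicator gT) (@mathcomp_extra.proj gT (fun=> bool) g) H).
  exact: initial_continuous.
exact: proj_continuous.
Qed.

Lemma closed_trivial_subgroup (gT : groupType) :
  closed [set trivial_subgroup gT].
Proof.
have -> : [set trivial_subgroup gT] =
    \bigcap_(g in [set g | g <> 1]) [set H | (g \in subgroup_set H) = false].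
  apply/seteqP; split=> [_ -> g g1|H H1].
    by apply/negbTE/negP => /set_mem.
  apply/subgroup_inj/seteqP; split=> [g Hg|_ ->]; last exact: subgroup1.
  by apply: contrapT => g1; have := H1 g g1; rewrite /= mem_set.
apply: closed_bigI => g _.
apply: (@preimage_closed _ _ _ [set false]); last exact: discrete_closed.
by move=> H _; exact: eval_indicator_continuous.
Qed.

(** The sets of the subgroups avoiding a given finite set of non-trivial
    elements generate a filter, and this filter converges to the trivial
    subgroup because it does so coordinate by coordinate. *)
Lemma nbhs_trivial_subgroup (gT : groupType) (A : set (subgroup gT)) :
  nbhs (trivial_subgroup gT) A ->
  exists2 s : seq gT, 1 \notin s &
    forall H : subgroup gT, (forall p, p \in s -> ~ p \inG H) -> A H.
Proof.
pose N (s : seq gT) := [set H : subgroup gT | forall p, p \in s -> ~ p \inG H].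
pose F := filter_from [set s : seq gT | 1 \notin s] N.
have FF : Filter F.
  apply: filter_from_filter => [|s s' /= s1 s'1]; first by exists [::].
  exists (s ++ s'); first by rewrite /= mem_cat negb_or s1.
  by move=> H Hss'; split=> p ps; apply: Hss'; rewrite mem_cat ps ?orbT.
suff FA : F --> trivial_subgroup gT by move=> /FA[s s1 NA]; exists s.
have FI : (@subgroup_indicator gT) @ F -->
    subgroup_indicator (trivial_subgroup gT).
  apply/cvg_sup => g B /=.
  rewrite (@nbhsE (initial_topology _)) => -[_ [[D _ <-] /= Dg] DB].
  apply: filterS DB _.
  have [g1|/eqP g1] := eqVneq g 1.
    exists [::] => // H _ /=; move: Dg; congr D.
    by rewrite /subgroup_indicator g1 !mem_set//; exact: subgroup1.
  exists [:: g]; first by rewrite /= inE; apply/eqP => /esym.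
  move=> H /(_ g (mem_head _ _)) Hg /=; move: Dg; congr D.
  by rewrite /subgroup_indicator !memNset.
move=> B; rewrite (@nbhsE (initial_topology _)) => -[_ [[D oD <-] /= DT] DB].
by apply: filterS DB _; apply: FI; exact: open_nbhs_nbhs.
Qed.

(** By minimality the trivial subgroup is not in the URS, which is closed and so
    also misses a neighbourhood of the trivial subgroup. *)
Lemma urs_hitting_set (gT : groupType) (Hs : set (subgroup gT)) :
  urs Hs -> Hs <> [set trivial_subgroup gT] ->
  exists2 s : seq gT, 1 \notin s &
    forall H, Hs H -> exists2 p, p \in s & p \inG H.
Proof.
move=> [_ Hs_closed _ Hs_min] Hs_nontriv.
have HsN1 : ~ Hs (trivial_subgroup gT).
  move=> Hs1; apply/Hs_nontriv/esym/Hs_min => [||g _ ->|_ ->//].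
  - by exists (trivial_subgroup gT).
  - exact: closed_trivial_subgroup.
  - apply/subgroup_inj/seteqP; split=> [_ [_ -> <-]|_ ->] /=.
      exact: conj1g.
    by exists 1 => //; exact: conj1g.
have [s s1 sHs] : exists2 s : seq gT, 1 \notin s &
    forall H : subgroup gT, (forall p, p \in s -> ~ p \inG H) -> ~ Hs H.
  apply: nbhs_trivial_subgroup; apply: open_nbhs_nbhs; split=> //.
  exact: closed_openC.
exists s => // H HsH; apply: contrapT => Hs0; apply: (sHs H) => // p ps Hp.
by apply: Hs0; exists p.
Qed.

(** * Rigid stabilizers as subquotients *)

Section RigidStabilizers.
Variables (X : topologicalType) (G : subgroup (homeo X)).
Notation gT := (subgroup_type G).
Implicit Types (g h p q r : gT) (V : set X) (U : gT -> set X) (s : seq gT).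

Definition homeo_act g (x : X) : X := (val g : homeo X) x.
Local Notation "g \act x" := (homeo_act g x) (at level 39, right associativity).

Lemma homeo_act1 x : (1 : gT) \act x = x.
Proof. by []. Qed.

Lemma homeo_actM g h x : (g * h) \act x = g \act h \act x.
Proof. by []. Qed.

Lemma homeo_actK g : cancel (homeo_act g) (homeo_act g^-1).
Proof. by move=> x; rewrite -homeo_actM mulVg. Qed.

Lemma homeo_actVK g : cancel (homeo_act g^-1) (homeo_act g).
Proof. by move=> x; rewrite -homeo_actM mulgV. Qed.

Lemma homeo_act_inj g : injective (homeo_act g).
Proof. exact: can_inj (homeo_actK g). Qed.

Lemma homeo_act_moved g : g <> 1 -> exists x, g \act x <> x.
Proof.
move=> g1; apply: contrapT => g_fix; apply/g1/val_inj/homeo_eq => x.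
by apply: contrapT => gx; apply: g_fix; exists x.
Qed.

Lemma open_homeo_act g V : open V -> open [set x | V (g \act x)].
Proof.
by apply: open_comp => x _; exact: (@homeo_continuous X (val g)).
Qed.

Lemma rigid_fix V g x : g \inG rigid_stabilizer G V -> ~ V x -> g \act x = x.
Proof. by apply. Qed.

Lemma rigid_stable V g x : g \inG rigid_stabilizer G V -> V x -> V (g \act x).
Proof.
move=> gV Vx; apply: contrapT => Vgx.
by apply: (Vgx); rewrite [g \act x](homeo_act_inj (rigid_fix gV Vgx)).
Qed.

Definition agree_on V g h := forall x, V x -> g \act x = h \act x.

(** For these elements, restricting to V and extending by the identity gives a
    well-defined rigid element, since a rigid element is determined by its
    restriction to V ([agree_on_rigid_inj]). *)
Program Definition restriction_dom V : subgroup gT :=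
  @Subgroup gT [set g | exists2 h, h \inG rigid_stabilizer G V & agree_on V g h]
    _ _ _.
Next Obligation. by move=> V; exists 1 => //; exact: subgroup1. Qed.
Next Obligation.
move=> V g g' [h hV gh] [h' h'V gh']; exists (h * h') => [|x Vx].
  exact: subgroupM.
by rewrite !homeo_actM gh'// gh//; exact: rigid_stable.
Qed.
Next Obligation.
move=> V g [h hV gh]; have hV' := subgroupV hV; exists h^-1 => // x Vx.
apply: (@homeo_act_inj g); rewrite homeo_actVK gh ?homeo_actVK//.
exact: rigid_stable.
Qed.

Definition restriction_fun V g : subgroup_type (rigid_stabilizer G V) :=
  xget 1 [set h | agree_on V g (val h)].

Lemma agree_on_rigid_inj V (h h' : subgroup_type (rigid_stabilizer G V)) :
  agree_on V (val h) (val h') -> h = h'.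
Proof.
move=> hh'; do 2 apply: val_inj; apply: homeo_eq => x.
have [/hh'//|Vx] := pselect (V x).
rewrite -!/(homeo_act _ x).
by rewrite (rigid_fix (subgroup_typeP h))// (rigid_fix (subgroup_typeP h')).
Qed.

Lemma restriction_funE V g (h : subgroup_type (rigid_stabilizer G V)) :
  agree_on V g (val h) -> restriction_fun V g = h.
Proof.
move=> gh; apply: agree_on_rigid_inj => x Vx; rewrite -gh//.
have := @xgetPex _ 1 [set h | agree_on V g (val h)] (ex_intro _ h gh).
by move=> /(_ x Vx).
Qed.

Program Definition restriction V :
    partial_hom gT (subgroup_type (rigid_stabilizer G V)) :=
  @PartialHom _ _ (restriction_dom V) (restriction_fun V) _.
Next Obligation.
move=> V g g' [h hV gh] [h' h'V gh'].
rewrite (@restriction_funE V g (insubd 1 h)) ?val_insubd_subgroup//.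
rewrite (@restriction_funE V g' (insubd 1 h')) ?val_insubd_subgroup//.
apply: restriction_funE => x Vx; rewrite subvalM !val_insubd_subgroup//.
by rewrite !homeo_actM gh'// gh//; exact: rigid_stable.
Qed.

(** The supports are disjoint, so the product of the elements c p, over the
    distinct p in s, acts on each U p as c p. *)
Lemma disjoint_gluing s U (c : gT -> gT) :
  {in s &, forall p q, p <> q -> forall x, U p x -> ~ U q x} ->
  {in s, forall p, c p \inG rigid_stabilizer G (U p)} ->
  exists d : gT, {in s, forall p, agree_on (U p) d (c p)} /\
    forall x, {in s, forall p, ~ U p x} -> d \act x = x.
Proof.
elim: s => [|p s IHs] Udisj cU; first by exists 1.
have [q r qs rs|q qs|d [dU d_fix]] := IHs _ _.
- by apply: Udisj; rewrite inE ?qs ?rs orbT.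
- by apply: cU; rewrite inE qs orbT.
have ps := mem_head p s; have sub_s q : q \in s -> q \in p :: s.
  by move=> qs; rewrite inE qs orbT.
have [pins|pNs] := boolP (p \in s).
  exists d; split=> [q|x Ux]; first by rewrite inE => /predU1P[->|]; exact: dU.
  by apply: d_fix => q /sub_s; exact: Ux.
exists (c p * d); split=> [q|x Ux].
  rewrite inE => /predU1P[-> x Ux|qs x Ux]; rewrite homeo_actM.
    rewrite d_fix// => r rs; apply: (Udisj p r) => //; first exact: sub_s.
    by move=> pr; rewrite pr rs in pNs.
  rewrite (dU q qs x Ux) (rigid_fix (cU p ps))//; apply: (Udisj q p) => //.
  - exact: sub_s.
  - by move=> qp; rewrite -qp qs in pNs.
  - by apply: rigid_stable => //; exact/cU/sub_s.
by rewrite homeo_actM d_fix ?(rigid_fix (cU p ps))// => [|q /sub_s];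
  apply: Ux.
Qed.

(** If p is in d H d^-1 and d acts on each U q as an element c q of its rigid
    stabilizer and trivially off these sets, then d^-1 p d in H agrees with
    p (c p) on U p.  A diagonal argument over the choices of c yields one p for
    which c p can be arbitrary, and quotients of two of these elements of H
    restrict to arbitrary elements of the rigid stabilizer of U p. *)
Lemma rigid_stabilizer_subquotient s U (H : subgroup gT) :
  {in s &, forall p q, p <> q -> forall x, U p x -> ~ U q x} ->
  {in s &, forall p q x, U p x -> ~ U q (p \act x)} ->
  (forall g, exists2 p, p \in s & p \inG conj_subgroup g H) ->
  exists2 p, p \in s &
    subquotient (subgroup_type H) (subgroup_type (rigid_stabilizer G (U p))).
Proof.
move=> Udisj Umove Hs.
have [p ps pU] : exists2 p, p \in s & forall c,
    c \inG rigid_stabilizer G (U p) ->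
    exists2 h, h \inG H & agree_on (U p) h (p * c).
  apply: contrapT => noU.
  have /choice[c cP] : forall p, exists c, p \in s ->
      c \inG rigid_stabilizer G (U p) /\
      ~ exists2 h, h \inG H & agree_on (U p) h (p * c).
    move=> p; have [ps|_] := boolP (p \in s); last by exists 1.
    apply: contrapT => noc; apply: noU; exists p => // c cU.
    by apply: contrapT => noh; apply: noc; exists c.
  (* Every p has a counterexample c p; the gluing d of these refutes one. *)
  have [|d [dU d_fix]] := @disjoint_gluing s U c Udisj.
    by move=> p ps; exact: (cP p ps).1.
  have [p ps [h Hh hp]] := Hs d; have [cU noh] := cP p ps; apply: noh.
  exists h => // x Ux; apply: (@homeo_act_inj d).
  have -> : h = p ^ d by rewrite -hp conjgKV.
  rewrite -homeo_actM conjgE mulVKg !homeo_actM (dU p ps x Ux) d_fix// => q qs.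
  by apply: Umove => //; exact: rigid_stable.
exists p => //; exists (phom_comp (restriction (U p)) (phom_val H)) => c.
have cU := subgroup_typeP c.
have [h0 Hh0 h0p] := pU 1 (subgroup1 _); have [h Hh hpc] := pU _ cU.
have Hh0h : h0^-1 * h \inG H by apply: subgroupM => //; exact: subgroupV.
have h0hc : agree_on (U p) (h0^-1 * h) (val c).
  move=> x Ux; apply: (@homeo_act_inj h0); rewrite -homeo_actM mulVKg hpc//.
  by rewrite h0p ?mulg1//; exact: rigid_stable.
exists (insubd (1 : subgroup_type H) (h0^-1 * h)).
  by split=> //; exists (val c) => //; rewrite /= val_insubd_subgroup.
by apply: restriction_funE; rewrite /= val_insubd_subgroup.
Qed.

Hypothesis hX : hausdorff_space X.

Lemma hausdorff_separation (x y : X) : x <> y ->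
  exists A B, [/\ open A, open B, A x, B y & forall z, A z -> ~ B z].
Proof.
move=> /eqP xy; have := hX; rewrite open_hausdorff => /(_ x y xy).
move=> [[A B] /= [/set_mem Ax /set_mem By] [oA oB /eqP AB]].
exists A, B; split=> // z Az Bz.
by have : (A `&` B) z by []; rewrite AB.
Qed.

Lemma displaced_open_sets s : 1 \notin s ->
  exists U, {in s, forall p, [/\ open (U p), U p !=set0 &
    forall x, U p x -> ~ U p (p \act x)]}.
Proof.
move=> s1; suff /choice[U UP] : forall p, exists V, p \in s ->
    [/\ open V, V !=set0 & forall x, V x -> ~ V (p \act x)].
  by exists U => p /UP.
move=> p; have [ps|_] := boolP (p \in s); last by exists set0.
have p1 : p <> 1 by move=> p1; rewrite p1 (negbTE s1) in ps.
have [x px] := homeo_act_moved p1.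
have [A [B [oA oB Ax Bx AB]]] := hausdorff_separation px.
exists ([set z | A (p \act z)] `&` B) => _; split; last first.
- by move=> z [Az _] [_ Bz]; exact: AB Az Bz.
- by exists x.
- by apply: openI => //; exact: open_homeo_act.
Qed.

(** Each of the finitely many conditions g (U p) disjoint from U q, with p <> q
    and g = 1 or g = p, survives shrinking the family, so they can be achieved
    one after the other.  Without isolated points U q has a point other than
    g x, for x in U p, and separating the two points gives the shrunken sets. *)
Lemma disjoint_displaced_open_sets s : 1 \notin s ->
  (forall x : X, ~ open [set x]) ->
  exists U, [/\ {in s, forall p, open (U p) /\ U p !=set0},
    {in s &, forall p q, p <> q -> forall x, U p x -> ~ U q x} &
    {in s &, forall p q x, U p x -> ~ U q (p \act x)}].
Proof.
move=> s1 noiso.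
have other V z : open V -> V !=set0 -> exists2 y, V y & z <> y.
  move=> oV [y0 Vy0]; apply: contrapT => Vz; apply: (noiso z).
  have VzE y : V y -> z = y.
    by move=> Vy; apply: contrapT => zy; apply: Vz; exists y.
  suff -> : [set z] = V by [].
  by apply/seteqP; split=> [_ ->|y /VzE ->//]; rewrite (VzE y0).
pose avoids (L : seq (gT * gT * gT)) U := forall p q g, (p, q, g) \in L ->
  p \in s -> q \in s -> p <> q -> forall x, U p x -> ~ U q (g \act x).
have shrink L : exists U, {in s, forall p, [/\ open (U p), U p !=set0 &
    forall x, U p x -> ~ U p (p \act x)]} /\ avoids L U.
  (* L lists the triples (p, q, g) whose conditions have been achieved. *)
  elim: L => [|[[p q] g] L [U [Us UL]]].
    by have [U Us] := displaced_open_sets s1; exists U.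
  have [[ps [qs pq]]|triv] :=
    pselect (p \in s /\ q \in s /\ p <> q); last first.
    exists U; split=> // p' q' g'; rewrite inE => /predU1P[[-> -> _] ps qs pq|].
      by case: triv.
    exact: UL.
  have [[oUp [x Ux] _] [oUq Uq0 _]] := (Us p ps, Us q qs).
  have [y Uy /hausdorff_separation[A [B [oA oB Ax By AB]]]] :=
    other (U q) (g \act x) oUq Uq0.
  pose U' r := if r == p then U p `&` [set z | A (g \act z)]
    else if r == q then U q `&` B else U r.
  have U'U r z : U' r z -> U r z.
    by rewrite /U'; case: eqP => [-> []//|_]; case: eqP => [-> []|].
  have U'p : U' p = U p `&` [set z | A (g \act z)] by rewrite /U' eqxx.
  have U'q : U' q = U q `&` B by rewrite /U' eqxx; case: eqP => // /esym/pq.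
  exists U'; split=> [r rs|p' q' g' + p's q's p'q'].
    have [oUr Ur0 Ur] := Us r rs; split; last first.
    - by move=> z /U'U Uz /U'U; exact: Ur.
    - rewrite /U'; case: eqP => _; first by exists x.
      by case: eqP => _ //; exists y.
    - rewrite /U'; case: eqP => _.
        by apply: openI => //; exact: open_homeo_act.
      by case: eqP => _ //; exact: openI.
  rewrite inE => /predU1P[[-> -> ->] z|L' z /U'U Uz /U'U]; last first.
    exact: UL L' _ _ _ _ Uz.
  by rewrite U'p U'q => -[_ Az] [_]; exact: AB.
have [U [Us UL]] := shrink ([seq (p, q, 1) | p <- s, q <- s] ++
  [seq (p, q, p) | p <- s, q <- s]).
exists U; split=> [p /Us[]//|p q ps qs pq x|p q ps qs x].
  rewrite -[x in U q x]homeo_act1; apply: UL => //.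
  by rewrite mem_cat; apply/orP; left; apply/allpairsP; exists (p, q).
have [<-|pq] := pselect (p = q); first by have [_ _ Up] := Us p ps; exact: Up.
apply: UL => //.
by rewrite mem_cat; apply/orP; right; apply/allpairsP; exists (p, q).
Qed.

Lemma subquotient_trivial (gT' hT : groupType) :
  (forall y : hT, y = 1) -> subquotient gT' hT.
Proof.
move=> hT1; exists (@PartialHom gT' hT (full_subgroup gT') (fun=> 1)
  (fun _ _ _ _ => esym (hT1 _))) => y.
by exists 1; rewrite // [y]hT1.
Qed.

Lemma rigid_stabilizer1 (x : X)
  (g : subgroup_type (rigid_stabilizer G [set x])) : g = 1.
Proof.
apply: agree_on_rigid_inj => _ ->.
exact: (rigid_stable (subgroup_typeP g) (erefl x)).
Qed.

(** At an isolated point the rigid stabilizer is trivial, and the trivial group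
    is a subquotient of every group; this leaves the case without isolated
    points, where small displaced open sets exist. *)
Lemma urs_subquotient (Hs : set (subgroup gT)) (H : subgroup gT) :
  urs Hs -> Hs <> [set trivial_subgroup gT] -> Hs H ->
  exists V, [/\ open V, V !=set0 &
    subquotient (subgroup_type H) (subgroup_type (rigid_stabilizer G V))].
Proof.
move=> ursHs Hs_nontriv HsH.
have [[x ox]|noiso] := pselect (exists x : X, open [set x]).
  exists [set x]; split=> //; first by exists x.
  exact/subquotient_trivial/rigid_stabilizer1.
have [s s1 sHs] := urs_hitting_set ursHs Hs_nontriv.
have [|U [U_open Udisj Umove]] := disjoint_displaced_open_sets s1.
  by move=> x ox; apply: noiso; exists x.
have [|p ps sq] := @rigid_stabilizer_subquotient s U H Udisj Umove.
  by move=> g; apply: sHs; case: ursHs => _ _ Hs_conj _; exact: Hs_conj.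
by have [oU U0] := U_open p ps; exists (U p).
Qed.

End RigidStabilizers.

Local Close Scope group_scope.

Theorem theorem1p1 (R : realType) (X : topologicalType)
    (hX : hausdorff_space X)
    (G : subgroup (homeo X)) (hG : countable (subgroup_set G)) :
  [/\ (forall U : set X, open U -> U !=set0 ->
         ~ amenable R (subgroup_type (rigid_stabilizer G U))) ->
      forall Hs : set (subgroup (subgroup_type G)),
        urs Hs -> Hs <> [set trivial_subgroup (subgroup_type G)] ->
        forall H, Hs H -> ~ amenable R (subgroup_type H),

      (forall U : set X, open U -> U !=set0 ->
         has_nonabelian_free_subgroup (subgroup_type (rigid_stabilizer G U))) ->
      forall Hs : set (subgroup (subgroup_type G)),
        urs Hs -> Hs <> [set trivial_subgroup (subgroup_type G)] ->
        forall H, Hs H -> has_nonabelian_free_subgroup (subgroup_type H),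

      (forall U : set X, open U -> U !=set0 ->
         ~ elementary_amenable (subgroup_type (rigid_stabilizer G U))) ->
      forall Hs : set (subgroup (subgroup_type G)),
        urs Hs -> Hs <> [set trivial_subgroup (subgroup_type G)] ->
        forall H, Hs H -> ~ elementary_amenable (subgroup_type H),

      (forall U : set X, open U -> U !=set0 ->
         ~ virtually_solvable (subgroup_type (rigid_stabilizer G U))) ->
      forall Hs : set (subgroup (subgroup_type G)),
        urs Hs -> Hs <> [set trivial_subgroup (subgroup_type G)] ->
        forall H, Hs H -> ~ virtually_solvable (subgroup_type H)
    & (forall U : set X, open U -> U !=set0 ->
         ~ locally_finite_group (subgroup_type (rigid_stabilizer G U))) ->
      forall Hs : set (subgroup (subgroup_type G)),
        urs Hs -> Hs <> [set trivial_subgroup (subgroup_type G)] ->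
        forall H, Hs H -> ~ locally_finite_group (subgroup_type H)].
Proof.
split=> rigid_big Hs ursHs Hs_nontriv H HsH;
  have [V [oV V0 sq]] := urs_subquotient hX ursHs Hs_nontriv HsH;
  have := rigid_big V oV V0.
- by apply: contra_not; exact: subquotient_amenable.
- exact: subquotient_nonabelian_free.
- by apply: contra_not; exact: subquotient_elementary_amenable.
- by apply: contra_not; exact: subquotient_virtually_solvable.
- by apply: contra_not; exact: subquotient_locally_finite.
Qed.
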